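(* Let $n\ge2$, $X=(x_1,\ldots,x_{n+1})^t$, and let $\chi=(P_1,\ldots,P_{n+1})$ be a homogeneous quadratic vector field on $\mathbb{S}^n$ with $P_i=X^tB_iX$, where each $B_i$ is a constant real symmetric $(n+1)\times(n+1)$ matrix. For $i=1,\ldots,n+1$ let $A_i:=[(B_1e_i)\ \cdots\ (B_{n+1}e_i)]$ be the $(n+1)\times(n+1)$ matrix whose $j$-th column is $B_je_i$, where $e_1,\ldots,e_{n+1}$ is the standard basis of $\mathbb{R}^{n+1}$. Let $\mathbf{a}=(a_1,\ldots,a_{n+1})^t\in\mathbb{R}^{n+1}$ with $\sum_i a_i^2=1$. Then $\{\mathbf{a}^tX=0\}\cap\mathbb{S}^n$ is an invariant great $(n-1)$-sphere of $\chi$ if and only if $$2\sum_{i=1}^{n+1}a_iB_i=\mathbf{a}\mathbf{b}^t+\mathbf{b}\mathbf{a}^t$$ for some (column vector) $\mathbf{b}\in\mathbb{R}^{n+1}$. Moreover, if $\mathbf{a}$ is an eigenvector of each $A_i$ with eigenvalue $\lambda_i$, then $\mathbf{a}^tX=0$ produces an invariant great $(n-1)$-sphere with cofactor $\sum_{i=1}^{n+1}\lambda_ix_i$.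
   Context: $\mathbb{S}^n=\{x\in\mathbb{R}^{n+1} : \sum_i x_i^2=1\}$. A polynomial vector field $\chi=(P_1,\ldots,P_{n+1})$ in $\mathbb{R}^{n+1}$ is identified with the operator $\sum_i P_i\,\partial/\partial x_i$; it is homogeneous if the $P_i$ are homogeneous polynomials of the same degree. It is a vector field on $\mathbb{S}^n$ if $\chi(\sum_i x_i^2-1)=K(\sum_i x_i^2-1)$ for some real polynomial $K$. A subset of $\mathbb{R}^{n+1}$ is invariant for $\chi$ if it is a union of trajectories of $\chi$. If $\chi f=Kf$ for polynomials $f,K$, then $\{f=0\}$ is an invariant algebraic set and $K$ is called the cofactor of $\chi$ for $\{f=0\}$. A great $(n-1)$-sphere in $\mathbb{S}^n$ is an intersection $\{\sum_{i=1}^{n+1}a_ix_i=0\}\cap\mathbb{S}^n$ with $\sum_i a_i^2=1$; it has cofactor $K$ here in the sense that $\chi(\mathbf{a}^tX)=K\,\mathbf{a}^tX$. *)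

(* Defs.v *)
From HB Require Import structures.
From mathcomp Require Import all_boot all_order all_algebra.
(* [mpoly] must be imported before the analysis files: in the other order its
   notations are rejected for an incompatible level associativity. *)
From mathcomp Require Import mpoly.
From mathcomp Require Import boolp classical_sets set_interval reals.
From mathcomp Require Import topology normedtype derive.

Set Implicit Arguments.
Unset Strict Implicit.
Unset Printing Implicit Defensive.

Import Order.TTheory GRing.Theory Num.Theory.
Import numFieldNormedType.Exports.

Local Open Scope classical_set_scope.
Local Open Scope ring_scope.

Definition vfield (R : realType) (m : nat) : Type := 'I_m -> {mpoly R[m]}.

Definition vf_apply (R : realType) (m : nat) (chi : vfield R m)
    (f : {mpoly R[m]}) : {mpoly R[m]} :=
  \sum_(i < m) chi i * f^`M(i).

Definition vf_eval (R : realType) (m : nat) (chi : vfield R m)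
    (x : 'cV[R]_m) : 'cV[R]_m :=
  \col_(i < m) (chi i).@[fun j => x j 0].

(* The zero field is homogeneous of every degree. *)
Definition vf_homogeneous (R : realType) (m d : nat) (chi : vfield R m) : Prop :=
  forall i, chi i \is d.-homog.

Definition has_cofactor (R : realType) (m : nat) (chi : vfield R m)
    (f K : {mpoly R[m]}) : Prop :=
  vf_apply chi f = K * f.

(* The unit sphere of R^m, i.e. S^(m-1). *)
Definition unit_sphere (R : realType) (m : nat) : set 'cV[R]_m :=
  [set x | \sum_(i < m) x i 0 ^+ 2 = 1].
Arguments unit_sphere : clear implicits.

Definition sphere_poly (R : realType) (m : nat) : {mpoly R[m]} :=
  \sum_(i < m) 'X_i ^+ 2 - 1.

Definition vf_on_sphere (R : realType) (m : nat) (chi : vfield R m) : Prop :=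
  exists K : {mpoly R[m]}, has_cofactor chi (sphere_poly R m) K.

(* Since [I] is open, the derivative of [g] at a point of [I] only depends on
   the restriction of [g] to [I]; the values of [g] outside [I] are junk. *)
Definition integral_curve (R : realType) (m : nat) (chi : vfield R m)
    (I : set R) (g : R -> 'cV[R]_m) : Prop :=
  [/\ I !=set0, open I, is_interval I &
      forall t, I t -> is_derive t (1 : R) g (vf_eval chi (g t))].

Definition maximal_integral_curve (R : realType) (m : nat) (chi : vfield R m)
    (I : set R) (g : R -> 'cV[R]_m) : Prop :=
  integral_curve chi I g /\
  forall (J : set R) (h : R -> 'cV[R]_m), integral_curve chi J h ->
    I `<=` J -> (forall t, I t -> h t = g t) -> J = I.

Definition trajectory (R : realType) (m : nat) (chi : vfield R m)
    (T : set 'cV[R]_m) : Prop :=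
  exists (I : set R) (g : R -> 'cV[R]_m),
    maximal_integral_curve chi I g /\ T = g @` I.

Definition invariant_set (R : realType) (m : nat) (chi : vfield R m)
    (S : set 'cV[R]_m) : Prop :=
  exists F : set (set 'cV[R]_m),
    (forall T, F T -> trajectory chi T) /\ S = \bigcup_(T in F) T.

Definition linear_form (R : realType) (m : nat) (a : 'cV[R]_m) : {mpoly R[m]} :=
  \sum_(i < m) a i 0 *: 'X_i.

Definition hyperplane_section (R : realType) (m : nat) (a : 'cV[R]_m) :
    set 'cV[R]_m :=
  [set x : 'cV[R]_m | \sum_(i < m) a i 0 * x i 0 = 0] `&` unit_sphere R m.

Definition great_sphere (R : realType) (m : nat) (S : set 'cV[R]_m) : Prop :=
  exists a : 'cV[R]_m,
    \sum_(i < m) a i 0 ^+ 2 = 1 /\ S = hyperplane_section a.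

Definition invariant_great_sphere (R : realType) (m : nat) (chi : vfield R m)
    (S : set 'cV[R]_m) : Prop :=
  great_sphere S /\ invariant_set chi S.

(* X^t B X, computed with matrices of polynomials. *)
Definition quadratic_form (R : realType) (m : nat) (B : 'M[R]_m) :
    {mpoly R[m]} :=
  let X : 'cV[{mpoly R[m]}]_m := \col_(i < m) 'X_i in
  (X^T *m map_mx (fun c : R => c%:MP) B *m X) 0 0.

(* The matrix whose [j]-th column is B_j e_i. *)
Definition column_matrix (R : realType) (m : nat) (B : 'I_m -> 'M[R]_m)
    (i : 'I_m) : 'M[R]_m :=
  \matrix_(k < m, j < m) (B j *m (delta_mx i 0 : 'cV[R]_m)) k 0.

(* Right (column) eigenvectors; [eigenspace] in MathComp is about row vectors. *)
Definition eigenvector (R : realType) (m : nat) (M : 'M[R]_m) (l : R)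
    (v : 'cV[R]_m) : Prop :=
  v != 0 /\ M *m v = l *: v.

(* Main.v *)
Require Import Defs.
From HB Require Import structures.
From mathcomp Require Import all_boot all_order all_algebra.
From mathcomp Require Import mpoly.
From mathcomp Require Import boolp classical_sets functions set_interval reals.
From mathcomp Require Import topology normedtype sequences derive realfun exp.
From mathcomp Require Import measure lebesgue_measure lebesgue_integral ftc.
From mathcomp Require Import ring lra.

(** Write [Q] for the symmetric matrix [\sum_i a_i B_i], so that
    [a . chi(x) = x^T Q x].

    If the section [{a . x = 0}] of the sphere is a union of trajectories, then
    [a . g(t)] is constantly zero along each of them, and differentiating gives
    [x^T Q x = 0] on the section, hence on the whole hyperplane by homogeneity
    ([invariant_section_orthogonal], [homogeneous_eq0_on_hyperplane]).
    Polarizing and splitting each vector into its component along [a] and its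
    component orthogonal to [a] yields [2 Q = a b^T + b a^T] with
    [b = 2 Q a - (a^T Q a) a] ([sym_mulmx_eq0_on_hyperplane]).

    Conversely the identity gives [a . chi(x) = (a . x) (b . x)], so [chi] is
    tangent to the hyperplane as well as to the sphere. Invariance asks more
    than tangency: each point of the section must lie on a maximal trajectory
    that never leaves the section. The section being compact, such a trajectory
    is defined for all times, and a curve defined on the whole line is maximal
    because it has no room for extension
    ([invariant_great_sphere_of_complete_curves]). To build it, [chi] is replaced by a bounded, globally Lipschitz field that agrees with it on the
    section: compose [chi] with a retraction onto the unit ball and remove the
    component along [a]. Picard iteration gives a complete integral curve of the
    modified field ([global_solution_of_bounded_lipschitz]), and both [a . g]
    and [g . g] are conserved by it; therefore the curve stays in the section,
    where the modification is invisible
    ([complete_curve_in_hyperplane_section]).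

    When [a] is an eigenvector of every [A_i], the [i]-th column of [Q] is
    [A_i a = lambda_i a], that is, [Q = a lambda^T]. By symmetry
    [2 Q = a lambda^T + lambda a^T], and the quadratic form of [a lambda^T] is
    the product of the two linear forms, which is the cofactor equation. *)

Set Implicit Arguments.
Unset Strict Implicit.
Unset Printing Implicit Defensive.

Import Order.TTheory GRing.Theory Num.Theory.
Import numFieldNormedType.Exports.

Local Open Scope classical_set_scope.
Local Open Scope ring_scope.

(** * Comparison of increments and primitives on the line *)

(** The mean value theorem applied to [g + f] and to [g - f], which are both
    nondecreasing. It stands in for the integral bound
    [|\int f'| <= \int |f'|]. *)
Lemma normB_le_of_derive_le (R : realType) (f g df dg : R -> R) (a b : R) :
  a <= b ->
  (forall x, x \in `[a, b] -> is_derive x 1 f (df x)) ->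
  (forall x, x \in `[a, b] -> is_derive x 1 g (dg x)) ->
  (forall x, x \in `[a, b] -> `|df x| <= dg x) ->
  `|f b - f a| <= g b - g a.
Proof.
move=> ab hf hg hfg.
have key (h dh : R -> R) : (forall x, x \in `[a, b] -> is_derive x 1 h (dh x)) ->
    (forall x, x \in `[a, b] -> 0 <= dh x) -> 0 <= h b - h a.
  move=> hh hpos.
  have oc x : x \in `]a, b[ -> x \in `[a, b].
    by rewrite !in_itv /= => /andP[/ltW -> /ltW ->].
  have hoo x : x \in `]a, b[ -> is_derive x 1 h (dh x) by move=> /oc; exact: hh.
  have hc : {within `[a, b], continuous h}.
    apply: derivable_within_continuous => x /hh dhx.
    exact: (@ex_derive _ _ _ _ _ _ _ dhx).
  have [c cab hE] := @MVT_segment R h dh a b ab hoo hc.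
  by rewrite hE mulr_ge0 ?subr_ge0 ?hpos.
rewrite ler_norml; apply/andP; split.
- have H := key (fun x => g x + f x) (fun x => dg x + df x).
  suff: 0 <= g b + f b - (g a + f a) by lra.
  apply: H => x xab.
    by have := hf _ xab; have := hg _ xab => h1 h2; exact: (@is_deriveD _ _ _ g f).
  by have := hfg _ xab; rewrite ler_norml => /andP[]; lra.
- have H := key (fun x => g x - f x) (fun x => dg x - df x).
  suff: 0 <= (g b - f b) - (g a - f a) by lra.
  apply: H => x xab.
    by have := hf _ xab; have := hg _ xab => h1 h2; exact: (@is_deriveB _ _ _ g f).
  by have := hfg _ xab; rewrite ler_norml => /andP[]; lra.
Qed.

Lemma increments_eq_of_derive_eq (R : realType) (f g df : R -> R) (a b : R) :
  a <= b ->
  (forall x, x \in `[a, b] -> is_derive x 1 f (df x)) ->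
  (forall x, x \in `[a, b] -> is_derive x 1 g (df x)) ->
  f b - f a = g b - g a.
Proof.
move=> ab hf hg.
have : `|(f b - g b) - (f a - g a)| <= (0 : R) - 0.
  apply: (@normB_le_of_derive_le R (fun x => f x - g x) (cst 0) (cst 0) (cst 0))
    => // x xab; last by rewrite normr0.
    rewrite /= -(subrr (df x)); have h1 := hf _ xab; have h2 := hg _ xab.
    exact: (@is_deriveB _ _ _ f g).
by rewrite subrr normr_le0 => /eqP; lra.
Qed.

Lemma is_derive_coordP (R : realType) (m : nat) (g : R -> 'cV[R]_m) (t : R)
    (v : 'cV[R]_m) :
  is_derive t 1 g v <-> forall i, is_derive t 1 (fun s => g s i 0) (v i 0).
Proof.
split=> [[gt gv] i|H].
- have D := gt; move/derivable_mxP: gt => /(_ i 0) gi.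
  by split=> //; rewrite -gv derive_mx // mxE.
- have D : derivable g t 1.
    apply/derivable_mxP => i j; rewrite ord1.
    exact: (@ex_derive _ _ _ _ _ _ _ (H i)).
  split=> //; rewrite derive_mx //; apply/matrixP => i j.
  by rewrite mxE ord1; exact: (@derive_val _ _ _ _ _ _ _ (H i)).
Qed.

(** The fundamental theorem of calculus integrates from a fixed left end point,
    so it only reaches the points to the right of [- N]. *)
Lemma primitive_right (R : realType) (f : R -> R) (N : R) :
  continuous f -> 0 < N ->
  exists2 A : R -> R, A 0 = 0 & forall x, - N < x -> is_derive x 1 A (f x).
Proof.
move=> cf N0.
pose F y := (\int[lebesgue_measure]_(t in [set` `[- N, y]]) (f t))%R.
exists (fun x => F x - F 0); first by rewrite subrr.
move=> x Nx.
have [dF F'] : derivable F x 1 /\ (F^`())%classic x = f x.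
  apply: (@continuous_FTC1_closed _ _ _ _ (x + 1)) => //; last exact: cf.
    by rewrite ltrDl.
  apply: continuous_compact_integrable; first exact: segment_compact.
  exact: continuous_subspaceT.
rewrite -[f x]subr0; apply: (@is_deriveB _ _ _ F (cst (F 0))).
by apply: DeriveDef; [exact: dF|rewrite -F' derive1E].
Qed.

(** The primitives of [f] on the half-lines [x > - N] that vanish at 0 agree
    where they are defined, and they glue to a primitive on the line. *)
Lemma primitive_exists (R : realType) (f : R -> R) :
  continuous f ->
  exists2 A : R -> R, A 0 = 0 & forall x : R, is_derive x (1 : R) A (f x).
Proof.
move=> cf.
have /choice[A HA] (N : R) : exists A : R -> R, 0 < N ->
    A 0 = 0 /\ forall x : R, - N < x -> is_derive x (1 : R) A (f x).
  have [N0|N0] := ltP 0 N; last by exists id.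
  by have [A ? ?] := primitive_right cf N0; exists A.
have agree M N x : 0 < M -> 0 < N -> - M < x -> - N < x -> A M x = A N x.
  move=> M0 N0 Mx Nx; have [AM dM] := HA _ M0; have [AN dN] := HA _ N0.
  have E a b : a <= b -> - M < a -> - N < a ->
      A M b - A M a = A N b - A N a.
    move=> ab Ma Na; apply: (@increments_eq_of_derive_eq R _ _ f) => // y;
      rewrite in_itv /= => /andP[ay _].
    - by apply: dM; exact: lt_le_trans ay.
    - by apply: dN; exact: lt_le_trans ay.
  have [x0|/ltW x0] := leP x 0.
  - by have := E _ _ x0 Mx Nx; rewrite AM AN; lra.
  - by have := E _ _ x0; rewrite !oppr_lt0 AM AN !subr0; apply.
(* The value at [x] comes from a half-line containing [x]; on the unit interval
   around [x] the primitive attached to [|x| + 2] gives the same values. *)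
exists (fun x => A (`|x| + 1) x).
  by rewrite normr0 add0r; have [] := HA 1 ltr01.
move=> x.
have N0 : 0 < `|x| + 2 by have := normr_ge0 x; lra.
have [_ /(_ x) dA] := HA _ N0.
apply: (@near_eq_is_derive _ _ _ (A (`|x| + 2))).
  exists 1 => //= y /=; rewrite /ball_ /= => xy.
  have := normr_ge0 y; have := normr_ge0 x; have := ler_norm x; have := ler_norm y.
  have := ler_norm (- y); have := ler_norm (- x); have := ler_norm (x - y).
  have := ler_norm (-(x - y)); rewrite !normrN => *.
  by apply: agree; lra.
apply: dA; have := ler_norm (- x); rewrite normrN; lra.
Qed.

(** * Curves in a finite-dimensional space *)

Lemma coord_le_norm (R : realType) (m : nat) (x : 'cV[R]_m) (i : 'I_m) :
  `|x i 0| <= `|x|.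
Proof.
rewrite [leRHS]/Num.Def.normr /= mx_normrE.
exact: (le_bigmax _ (fun p : 'I_m * 'I_1 => `|x p.1 p.2|) (i, 0)).
Qed.

Lemma norm_le_coord (R : realType) (m : nat) (x : 'cV[R]_m) (c : R) :
  0 <= c -> (forall i, `|x i 0| <= c) -> `|x| <= c.
Proof.
move=> c0 H; rewrite [leLHS]/Num.Def.normr /= mx_normrE.
by apply: bigmax_le => // -[i j] _ /=; rewrite ord1.
Qed.

Lemma curve_normB_le (R : realType) (m : nat) (g dg : R -> 'cV[R]_m)
    (w dw : R -> R) (a b : R) :
  a <= b ->
  (forall x, x \in `[a, b] -> is_derive x (1 : R) g (dg x)) ->
  (forall x, x \in `[a, b] -> is_derive x (1 : R) w (dw x)) ->
  (forall x, x \in `[a, b] -> `|dg x| <= dw x) ->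
  `|g b - g a| <= w b - w a.
Proof.
move=> ab hg hw hgw; apply: norm_le_coord => [|i].
  apply: le_trans (normr_ge0 (0 - 0 : R)) _.
  apply: (@normB_le_of_derive_le R (cst 0) w (cst 0) dw) => // x xab.
  by rewrite normr0; apply: le_trans (hgw _ xab).
rewrite !mxE; apply: (@normB_le_of_derive_le R (fun s => g s i 0) w
  (fun s => dg s i 0) dw) => // x xab.
  by have /is_derive_coordP := hg _ xab.
exact: le_trans (coord_le_norm _ _) (hgw _ xab).
Qed.

Lemma curve_primitive_exists (R : realType) (m : nat) (f : R -> 'cV[R]_m)
    (x0 : 'cV[R]_m) :
  continuous f ->
  exists2 g : R -> 'cV[R]_m, g 0 = x0 &
    forall t : R, is_derive t 1 g (f t).
Proof.
move=> cf.
have /choice[A HA] (i : 'I_m) : exists A : R -> R, A 0 = 0 /\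
    forall t : R, is_derive t 1 A (f t i 0).
  have [|A] := @primitive_exists R (fun t => f t i 0); last by exists A.
  move=> t; apply: (@continuous_comp _ _ _ f (fun M : 'cV[R]_m => M i 0)).
    exact: cf.
  exact: coord_continuous.
exists (fun t => \col_i (x0 i 0 + A i t)).
  by apply/colP => i; rewrite mxE (HA i).1 addr0.
move=> t; apply/is_derive_coordP => i.
have -> : (fun s => (\col_j (x0 j 0 + A j s)) i 0) = (fun s => x0 i 0 + A i s).
  by apply/funext => s; rewrite mxE.
have dA := (HA i).2 t; have dc := is_derive_cst (x0 i 0) t (1 : R).
by rewrite -[f t i 0]add0r; exact: (@is_deriveD _ _ _ (cst (x0 i 0)) (A i)).
Qed.

(** * Complete integral curves of bounded Lipschitz fields *)

(** The sequences [v k - e k] and [v k + e k], with [e k = 2 c / 2 ^+ k], are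
    nondecreasing and nonincreasing respectively, because [e k - e k.+1] is the
    allowed step; the supremum of the first one lies below the second one. The
    bound on the distance is the sum of the remaining geometric tail. *)
Lemma geometric_limit (R : realType) (v : nat -> R) (c : R) :
  (forall k, `|v k.+1 - v k| <= c / 2 ^+ k) ->
  exists l : R, forall k, `|l - v k| <= 2 * c / 2 ^+ k.
Proof.
move=> hv.
have p2 k : (0 : R) < 2 ^+ k by rewrite exprn_gt0.
have c0 : 0 <= c by have := hv 0%N; rewrite expr0 divr1; exact: le_trans.
pose e k := 2 * c / 2 ^+ k.
have eS k : e k = e k.+1 + c / 2 ^+ k.
  by rewrite /e exprS; field; rewrite gt_eqF.
have e0 k : 0 <= e k by rewrite /e divr_ge0 ?mulr_ge0 // ltW.
pose a k := v k - e k; pose b k := v k + e k.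
have aS k : a k <= a k.+1.
  by have := hv k; have := eS k; rewrite ler_norml /a => ? /andP[]; lra.
have bS k : b k.+1 <= b k.
  by have := hv k; have := eS k; rewrite ler_norml /b => ? /andP[]; lra.
have am j k : (j <= k)%N -> a j <= a k.
  by move=> jk; apply: (@homo_leq _ a _ lexx le_trans) => //.
have bm j k : (j <= k)%N -> b k <= b j.
  move=> jk; apply: (@homo_leq _ b (fun x y => y <= x)) => //.
  by move=> y x z xy yz; apply: le_trans yz xy.
have ab j k : a j <= b k.
  apply: le_trans (am _ _ (leq_maxl j k)) _.
  apply: le_trans (bm _ _ (leq_maxr j k)); rewrite /a /b.
  by have := e0 (maxn j k); lra.
have ub k : ubound (range a) (b k) by move=> _ [j _ <-].
have hs : has_sup (range a).
  by split; [exists (a 0%N); exists 0%N|exists (b 0%N); exact: ub].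
exists (sup (range a)) => k; rewrite ler_norml; apply/andP; split.
  suff : a k <= sup (range a) by rewrite /a /e; lra.
  by apply: sup_upper_bound => //; exists k.
suff : sup (range a) <= b k by rewrite /b /e; lra.
by apply: sup_le_ub => //; case: hs.
Qed.

Lemma le_of_le_add_geometric (R : realType) (x y c : R) :
  (forall k, x <= y + c / 2 ^+ k) -> x <= y.
Proof.
move=> H; rewrite leNgt; apply/negP => yx.
have d0 : 0 < x - y by lra.
have [k hk] : exists k : nat, `|c| / (x - y) < k%:R.
  by eexists; apply: archi_boundP; rewrite divr_ge0 // ltW.
have kl : (k%:R : R) < 2 ^+ k by rewrite -natrX ltr_nat ltn_expl.
have := H k; have p2 : (0 : R) < 2 ^+ k by rewrite exprn_gt0.
rewrite -lerBlDl ler_pdivlMr // => h1.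
have : `|c| < 2 ^+ k * (x - y) by rewrite -ltr_pdivrMr //; apply: lt_trans kl.
by have := ler_norm c; rewrite mulrC; lra.
Qed.

(** Twice the hyperbolic cosine of [l t]. Being even, it serves as a growth
    weight for positive and negative times at once. *)
Definition cosh_weight (R : realType) (l t : R) : R :=
  expR (l * t) + expR (- (l * t)).

(** Integrating divides the weighted norm by [l]: a primitive of [cosh (l s)] is
    [sinh (l s) / l], which vanishes at 0 and is at most [cosh (l s) / l] in
    absolute value. With [l] twice a Lipschitz constant, this makes the
    Picard operator a contraction of ratio 1/2 on the whole line. *)
Lemma curve_norm_le_cosh_weight (R : realType) (m : nat)
    (g dg : R -> 'cV[R]_m) (K l : R) (t : R) :
  0 <= K -> 0 < l -> g 0 = 0 ->
  (forall s : R, is_derive s 1 g (dg s)) ->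
  (forall s, `|dg s| <= K * cosh_weight l s) ->
  `|g t| <= K / l * cosh_weight l t.
Proof.
move=> K0 l0 g0 hg hdg.
pose W s := K / l * (expR (l * s) - expR (- (l * s))).
have dW (s : R) : is_derive s 1 W (K * cosh_weight l s).
  have -> : K * cosh_weight l s =
      K / l * (expR (l * s) * (l * 1) - expR (- (l * s)) * (- (l * 1))).
    by rewrite /cosh_weight; field; rewrite gt_eqF.
  have d1 := is_derive_id s (1 : R).
  have d2 : is_derive s 1 (fun s => l * s) (l * 1) by exact: is_deriveZ.
  have d3 : is_derive s 1 (fun s => - (l * s)) (- (l * 1)) by exact: is_deriveN.
  have d4 : is_derive s 1 (fun s => expR (l * s)) (expR (l * s) * (l * 1)).
    exact: (@is_derive1_comp _ expR (fun s => l * s)).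
  have d5 : is_derive s 1 (fun s => expR (- (l * s)))
      (expR (- (l * s)) * (- (l * 1))).
    exact: (@is_derive1_comp _ expR (fun s => - (l * s))).
  have d6 : is_derive s 1 (fun s => expR (l * s) - expR (- (l * s)))
      (expR (l * s) * (l * 1) - expR (- (l * s)) * (- (l * 1))).
    exact: (@is_deriveB _ _ _ (fun s => expR (l * s))).
  exact: (@is_deriveZ _ _ _ (fun s => expR (l * s) - expR (- (l * s)))).
have W0 : W 0 = 0 by rewrite /W mulr0 oppr0 subrr mulr0.
have Kl : 0 <= K / l by rewrite divr_ge0 // ltW.
have e1 := expR_ge0 (l * t); have e2 := expR_ge0 (- (l * t)).
have [t0|/ltW t0] := leP 0 t.
- have := @curve_normB_le R m g dg W _ 0 t t0 (fun s _ => hg s)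
    (fun s _ => dW s) (fun s _ => hdg s).
  rewrite g0 W0 !subr0 => /le_trans; apply.
  by rewrite /W /cosh_weight ler_wpM2l //; lra.
- have := @curve_normB_le R m g dg W _ t 0 t0 (fun s _ => hg s)
    (fun s _ => dW s) (fun s _ => hdg s).
  rewrite g0 W0 !sub0r normrN => /le_trans; apply.
  by rewrite /W /cosh_weight -mulrN ler_wpM2l //; lra.
Qed.

Lemma lipschitz_curve_continuous (R : realType) (m : nat) (g : R -> 'cV[R]_m)
    (C : R) :
  (forall s t, `|g s - g t| <= C * `|s - t|) -> continuous g.
Proof.
move=> hg t; apply/cvgrPdist_le => e e0.
have C1 : 0 < `|C| + 1 by have := normr_ge0 C; lra.
near=> s.
apply: le_trans (hg _ _) _.
apply: (@le_trans _ _ ((`|C| + 1) * `|t - s|)).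
  by rewrite ler_wpM2r //; have := ler_norm C; lra.
rewrite -ler_pdivlMl // mulrC.
near: s; apply: cvgr_dist_le => //; exact: divr_gt0.
Unshelve. all: by end_near. Qed.

Lemma curve_lipschitz_of_derive_le (R : realType) (m : nat)
    (g dg : R -> 'cV[R]_m) (C : R) :
  (forall t : R, is_derive t 1 g (dg t)) -> (forall t, `|dg t| <= C) ->
  forall s t, `|g s - g t| <= C * `|s - t|.
Proof.
move=> hg hC s t; wlog st : s t / t <= s => [H|].
  have [|/ltW st] := leP t s; first exact: H.
  by rewrite distrC [`|s - t|]distrC; exact: H.
rewrite ger0_norm ?subr_ge0 // mulrBr.
apply: (@curve_normB_le R m g dg (fun s => C * s) (cst (C * 1))) => // x _.
by rewrite /= mulr1.
Qed.

(** Picard iteration. The boundedness of [F] makes every iterate Lipschitz with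
    the same constant [C], a property that passes to the pointwise limit and
    gives its continuity. The weighted norm makes the
    differences of consecutive iterates decay like [2 ^- k] relative to the
    weight at all times simultaneously, hence a solution on the whole line. *)
Lemma global_solution_of_bounded_lipschitz (R : realType) (m : nat)
    (F : 'cV[R]_m -> 'cV[R]_m) (C L : R) (x0 : 'cV[R]_m) :
  (forall x, `|F x| <= C) ->
  (forall x y, `|F x - F y| <= L * `|x - y|) ->
  exists2 g : R -> 'cV[R]_m, g 0 = x0 &
    forall t : R, is_derive t 1 g (F (g t)).
Proof.
move=> FC FL.
have C0 : 0 <= C by apply: le_trans (FC 0).
pose M := `|L| + 1.
have M0 : 0 < M by rewrite /M; have := normr_ge0 L; lra.
have FM x y : `|F x - F y| <= M * `|x - y|.
  apply: le_trans (FL x y) _; rewrite ler_wpM2r //.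
  by rewrite /M; have := ler_norm L; lra.
(* The rate that makes the contraction ratio [M / l] equal to 1/2. *)
pose l := 2 * M; have l0 : 0 < l by rewrite mulr_gt0.
pose w := cosh_weight l.
have w1 t : 1 <= w t.
  rewrite /w /cosh_weight; have := expR_ge1Dx (l * t).
  have := expR_ge1Dx (- (l * t)).
  have := expR_ge0 (l * t); have := expR_ge0 (- (l * t)).
  by lra.
have p2 k : (0 : R) < 2 ^+ k by rewrite exprn_gt0.
have /choice[prim primP] (f : R -> 'cV[R]_m) : exists g : R -> 'cV[R]_m,
    continuous f -> g 0 = x0 /\ forall t : R, is_derive t 1 g (f t).
  have [cf|ncf] := pselect (continuous f); last by exists f.
  by have [g] := curve_primitive_exists x0 cf; exists g.
have contF v : (forall s t, `|v s - v t| <= C * `|s - t|) ->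
    continuous (fun s : R => F (v s)).
  move=> vC; apply: (@lipschitz_curve_continuous _ _ _ (M * C)) => s t.
  by apply: le_trans (FM _ _) _; rewrite -mulrA ler_wpM2l // ltW.
pose u := fix u k := if k is k'.+1 then prim (fun s => F (u k' s)) else cst x0.
have uC k : forall s t, `|u k s - u k t| <= C * `|s - t|.
  elim: k => [|k IH] s t /=.
    by rewrite subrr normr0 mulr_ge0.
  have [_ d] := primP _ (contF _ IH).
  by apply: curve_lipschitz_of_derive_le d _ _ _ => r; exact: FC.
have u0 k : u k 0 = x0.
  by case: k => //= k; have [] := primP _ (contF _ (uC k)).
have uS k (t : R) : is_derive t 1 (u k.+1) (F (u k t)).
  by have [_] := primP _ (contF _ (uC k)).
(* The first step [u 1 - u 0] has velocity at most [C <= C * w]. *)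
pose K := C / l; have K0 : 0 <= K by rewrite divr_ge0 // ltW.
have step k t : `|u k.+1 t - u k t| <= K * w t / 2 ^+ k.
  elim: k t => [|k IH] t.
    rewrite expr0 divr1.
    apply: (@curve_norm_le_cosh_weight R m (fun s => u 1%N s - u 0%N s)
      (fun s => F (u 0%N s)) C) => //; first by rewrite !u0 subrr.
      move=> s; rewrite -[F _]subr0; have d1 := uS 0%N s.
      by have d2 := is_derive_cst x0 s (1 : R); exact: is_deriveB.
    move=> s; apply: le_trans (FC _) _.
    by rewrite ler_peMr.
  have -> : K * w t / 2 ^+ k.+1 = (M * K / 2 ^+ k) / l * w t.
    by rewrite /l exprS; field; rewrite !gt_eqF.
  apply: (@curve_norm_le_cosh_weight R m (fun s => u k.+2 s - u k.+1 s)
    (fun s => F (u k.+1 s) - F (u k s))) => //.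
  - by apply: divr_ge0; [apply: mulr_ge0 => //; exact: ltW|exact: ltW].
  - by rewrite !u0 subrr.
  move=> s; apply: le_trans (FM _ _) _.
  have -> : M * K / 2 ^+ k * cosh_weight l s = M * (K * w s / 2 ^+ k).
    by rewrite /w; field; rewrite gt_eqF.
  by rewrite ler_wpM2l // ltW.
have /choice[g gP] t : exists x : 'cV[R]_m,
    forall k, `|x - u k t| <= 2 * (K * w t) / 2 ^+ k.
  have /choice[x xP] i : exists x : R,
      forall k, `|x - u k t i 0| <= 2 * (K * w t) / 2 ^+ k.
    apply: geometric_limit => k; apply: le_trans (step k t).
    by have := coord_le_norm (u k.+1 t - u k t) i; rewrite !mxE.
  exists (\col_i x i) => k; apply: norm_le_coord => [|i]; last first.
    by rewrite !mxE.
  have wt := w1 t.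
  apply: divr_ge0; last exact: ltW.
  by apply: mulr_ge0 => //; apply: mulr_ge0 => //; exact: le_trans wt.
have gC s t : `|g s - g t| <= C * `|s - t|.
  apply: (@le_of_le_add_geometric _ _ _ (2 * (K * w s) + 2 * (K * w t))) => k.
  have := uC k s t; have := gP s k; have := gP t k => ht hs hst.
  have -> : g s - g t = (g s - u k s) + (u k s - u k t) - (g t - u k t).
    by rewrite addrA subrK opprB addrA subrK.
  apply: le_trans (ler_normB _ _) _.
  have := ler_normD (g s - u k s) (u k s - u k t).
  by rewrite mulrDl; lra.
(* The limit is a fixed point of the Picard operator: its image [v] is within
   [K * w t / 2 ^+ k] of [u k.+1], and so is [g]. *)
have [v v0 dv] := curve_primitive_exists x0 (contF _ gC).
suff vg : v = g by exists v => // t; have := dv t; rewrite -vg.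
apply/funext => t; apply/eqP; rewrite -subr_eq0 -normr_le0.
apply: (@le_of_le_add_geometric _ _ _ (2 * (K * w t))) => k; rewrite add0r.
have h1 : `|v t - u k.+1 t| <= K * w t / 2 ^+ k.
  have -> : K * w t / 2 ^+ k = (2 * M * K / 2 ^+ k) / l * w t.
    by rewrite /l; field; rewrite !gt_eqF.
  apply: (@curve_norm_le_cosh_weight R m (fun s => v s - u k.+1 s)
    (fun s => F (g s) - F (u k s))) => //.
  - apply: divr_ge0; last exact: ltW.
    by apply: mulr_ge0 => //; apply: mulr_ge0 => //; exact: ltW.
  - by rewrite v0 !u0 subrr.
  move=> s; apply: le_trans (FM _ _) _.
  have -> : 2 * M * K / 2 ^+ k * cosh_weight l s
      = M * (2 * (K * w s) / 2 ^+ k).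
    by rewrite /w; field; rewrite gt_eqF.
  by rewrite ler_wpM2l // ltW.
have h2 : `|g t - u k.+1 t| <= K * w t / 2 ^+ k.
  apply: le_trans (gP t k.+1) _.
  suff -> : 2 * (K * w t) / 2 ^+ k.+1 = K * w t / 2 ^+ k by [].
  by rewrite exprS; field; rewrite gt_eqF.
have -> : v t - g t = (v t - u k.+1 t) - (g t - u k.+1 t).
  by rewrite opprB addrA subrK.
by apply: le_trans (ler_normB _ _) _; lra.
Qed.

(** * Truncation of a polynomial field *)

(** Products of Lipschitz functions can fail to be Lipschitz; products of bounded
    ones do not, so that this class is stable under polynomial operations. *)
Definition bounded_lipschitz (R : realType) (m : nat) (f : 'cV[R]_m -> R) :=
  exists2 C : R, (forall x, `|f x| <= C) &
                 (forall x y, `|f x - f y| <= C * `|x - y|).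

Lemma bounded_lipschitz_cst (R : realType) (m : nat) (c : R) :
  bounded_lipschitz (fun _ : 'cV[R]_m => c).
Proof. by exists `|c| => // x y; rewrite subrr normr0 mulr_ge0. Qed.

Lemma bounded_lipschitzD (R : realType) (m : nat) (f g : 'cV[R]_m -> R) :
  bounded_lipschitz f -> bounded_lipschitz g ->
  bounded_lipschitz (fun x => f x + g x).
Proof.
move=> [C fC fL] [D gD gL]; exists (C + D) => [x|x y].
  by apply: le_trans (ler_normD _ _) _; exact: lerD.
rewrite opprD addrACA mulrDl.
by apply: le_trans (ler_normD _ _) _; exact: lerD.
Qed.

Lemma bounded_lipschitzM (R : realType) (m : nat) (f g : 'cV[R]_m -> R) :
  bounded_lipschitz f -> bounded_lipschitz g ->
  bounded_lipschitz (fun x => f x * g x).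
Proof.
move=> [C fC fL] [D gD gL].
have C0 : 0 <= C by apply: le_trans (fC 0).
have D0 : 0 <= D by apply: le_trans (gD 0).
exists (2 * C * D) => [x|x y].
  rewrite normrM; apply: (@le_trans _ _ (C * D)); first exact: ler_pM.
  by have := mulr_ge0 C0 D0; lra.
have -> : f x * g x - f y * g y = f x * (g x - g y) + (f x - f y) * g y by ring.
apply: le_trans (ler_normD _ _) _; rewrite !normrM.
have h1 : `|f x| * `|g x - g y| <= C * (D * `|x - y|) by exact: ler_pM.
have h2 : `|f x - f y| * `|g y| <= C * `|x - y| * D by exact: ler_pM.
by lra.
Qed.

Lemma bounded_lipschitzX (R : realType) (m : nat) (f : 'cV[R]_m -> R) (k : nat) :
  bounded_lipschitz f -> bounded_lipschitz (fun x => f x ^+ k).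
Proof.
move=> hf; elim: k => [|k IH]; first exact: bounded_lipschitz_cst.
by under eq_fun do rewrite exprS; exact: bounded_lipschitzM.
Qed.

Lemma bounded_lipschitz_sum (R : realType) (m : nat) (I : Type) (r : seq I)
    (f : I -> 'cV[R]_m -> R) :
  (forall i, bounded_lipschitz (f i)) ->
  bounded_lipschitz (fun x => \sum_(i <- r) f i x).
Proof.
move=> hf; elim: r => [|i r IH].
  by under eq_fun do rewrite big_nil; exact: bounded_lipschitz_cst.
by under eq_fun do rewrite big_cons; exact: bounded_lipschitzD.
Qed.

Lemma bounded_lipschitz_prod (R : realType) (m : nat) (I : Type) (r : seq I)
    (f : I -> 'cV[R]_m -> R) :
  (forall i, bounded_lipschitz (f i)) ->
  bounded_lipschitz (fun x => \prod_(i <- r) f i x).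
Proof.
move=> hf; elim: r => [|i r IH].
  by under eq_fun do rewrite big_nil; exact: bounded_lipschitz_cst.
by under eq_fun do rewrite big_cons; exact: bounded_lipschitzM.
Qed.

Lemma bounded_lipschitz_meval (R : realType) (m n : nat) (p : {mpoly R[n]})
    (f : 'I_n -> 'cV[R]_m -> R) :
  (forall i, bounded_lipschitz (f i)) ->
  bounded_lipschitz (fun x => p.@[fun i => f i x]).
Proof.
move=> hf; under eq_fun do rewrite mevalE.
apply: bounded_lipschitz_sum => mon.
apply: bounded_lipschitzM; first exact: bounded_lipschitz_cst.
by apply: bounded_lipschitz_prod => i; exact: bounded_lipschitzX.
Qed.

Lemma bounded_lipschitz_vector (R : realType) (m : nat)
    (F : 'cV[R]_m -> 'cV[R]_m) :
  (forall i, bounded_lipschitz (fun x => F x i 0)) ->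
  exists2 C : R, (forall x, `|F x| <= C) &
                 (forall x y, `|F x - F y| <= C * `|x - y|).
Proof.
move=> hF.
have /choice[C CP] i : exists C : R, (forall x, `|F x i 0| <= C) /\
    (forall x y, `|F x i 0 - F y i 0| <= C * `|x - y|).
  by have [C ? ?] := hF i; exists C.
have C0 i : 0 <= C i by apply: le_trans ((CP i).1 0).
have CS i : C i <= \sum_j C j.
  by rewrite (bigD1 i) //= lerDl; apply: sumr_ge0.
have S0 : 0 <= \sum_j C j by exact: sumr_ge0.
exists (\sum_j C j) => [x|x y].
  by apply: norm_le_coord => // i; apply: le_trans (CS i); exact: (CP i).1.
apply: norm_le_coord => [|i]; first exact: mulr_ge0.
rewrite !mxE; apply: le_trans ((CP i).2 x y) _.
exact: ler_wpM2r.
Qed.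

(** The ball is that of the maximum norm, the norm of the space of columns; it
    contains the Euclidean unit sphere. The value is a positive multiple of the
    argument, so it preserves the tangency of a homogeneous field to the
    spheres centred at 0. *)
Definition ball_retraction (R : realType) (m : nat) (x : 'cV[R]_m) : 'cV[R]_m :=
  (Num.max 1 `|x|)^-1 *: x.

Lemma ball_retraction_id (R : realType) (m : nat) (x : 'cV[R]_m) :
  `|x| <= 1 -> ball_retraction x = x.
Proof. by move=> x1; rewrite /ball_retraction max_l // invr1 scale1r. Qed.

Lemma bounded_lipschitz_ball_retraction (R : realType) (m : nat) (i : 'I_m) :
  bounded_lipschitz (fun x : 'cV[R]_m => ball_retraction x i 0).
Proof.
have M0 (x : 'cV[R]_m) : 0 < Num.max 1 `|x| by rewrite lt_max ltr01.
have bd (x : 'cV[R]_m) : `|ball_retraction x i 0| <= 1.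
  rewrite mxE normrM normfV (gtr0_norm (M0 x)) mulrC ler_pdivrMr // mul1r.
  by apply: le_trans (coord_le_norm _ _) _; rewrite le_max lexx orbT.
exists 2 => [x|x y]; first by apply: le_trans (bd x) _; lra.
set M := Num.max 1 `|x|; set N := Num.max 1 `|y|.
have M1 : 1 <= M by rewrite le_max lexx.
have MN : `|N - M| <= `|x - y|.
  have h1 := ler_dist_dist x y; rewrite ler_norml in h1; case/andP: h1 => h1 h2.
  rewrite ler_norml /M /N.
  have := normr_ge0 (x - y); have := normr_ge0 x; have := normr_ge0 y.
  by case: (leP 1 `|x|); case: (leP 1 `|y|); lra.
(* With [M] and [N] the denominators at [x] and [y]: the second term has norm at
   most [|N - M| <= |x - y|] since the retraction is bounded by 1. *)
have -> : ball_retraction x i 0 - ball_retraction y i 0 =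
    M^-1 * ((x i 0 - y i 0) + ball_retraction y i 0 * (N - M)).
  rewrite !mxE -/M -/N; field.
  by rewrite !gt_eqF //; exact: M0.
rewrite normrM normfV (gtr0_norm (M0 x)) mulrC ler_pdivrMr ?M0 //.
apply: (@le_trans _ _ (2 * `|x - y|)); last first.
  by rewrite ler_peMr // mulr_ge0.
apply: le_trans (ler_normD _ _) _; rewrite normrM.
have h1 : `|x i 0 - y i 0| <= `|x - y|.
  by have := coord_le_norm (x - y) i; rewrite !mxE.
have h2 : `|ball_retraction y i 0| * `|N - M| <= 1 * `|x - y| by exact: ler_pM.
by lra.
Qed.

(** * Complete trajectories in a great sphere *)

Definition dot (R : realType) (m : nat) (x y : 'cV[R]_m) : R :=
  \sum_(i < m) x i 0 * y i 0.

Lemma dotC (R : realType) (m : nat) (x y : 'cV[R]_m) : dot x y = dot y x.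
Proof. by apply: eq_bigr => i _; rewrite mulrC. Qed.

Lemma dotDr (R : realType) (m : nat) (x y z : 'cV[R]_m) :
  dot x (y + z) = dot x y + dot x z.
Proof. by rewrite -big_split; apply: eq_bigr => i _; rewrite mxE mulrDr. Qed.

Lemma dotZr (R : realType) (m : nat) (c : R) (x y : 'cV[R]_m) :
  dot x (c *: y) = c * dot x y.
Proof. by rewrite mulr_sumr; apply: eq_bigr => i _; rewrite mxE mulrCA. Qed.

Lemma dotBr (R : realType) (m : nat) (x y z : 'cV[R]_m) :
  dot x (y - z) = dot x y - dot x z.
Proof. by rewrite dotDr -scaleN1r dotZr mulN1r. Qed.

Lemma dotZl (R : realType) (m : nat) (c : R) (x y : 'cV[R]_m) :
  dot (c *: x) y = c * dot x y.
Proof. by rewrite dotC dotZr dotC. Qed.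

Lemma dotDl (R : realType) (m : nat) (x y z : 'cV[R]_m) :
  dot (x + y) z = dot x z + dot y z.
Proof. by rewrite dotC dotDr !(dotC z). Qed.

Lemma dotBl (R : realType) (m : nat) (x y z : 'cV[R]_m) :
  dot (x - y) z = dot x z - dot y z.
Proof. by rewrite dotC dotBr !(dotC z). Qed.

Lemma unit_sphereE (R : realType) (m : nat) (x : 'cV[R]_m) :
  unit_sphere R m x <-> dot x x = 1.
Proof.
by rewrite /unit_sphere /dot /=; under eq_bigr do rewrite expr2.
Qed.

Lemma hyperplane_sectionE (R : realType) (m : nat) (a x : 'cV[R]_m) :
  hyperplane_section a x <-> dot a x = 0 /\ dot x x = 1.
Proof.
by split=> -[h1 h2]; split=> //; apply/unit_sphereE.
Qed.

Lemma dot_gt0 (R : realType) (m : nat) (x : 'cV[R]_m) : x != 0 -> 0 < dot x x.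
Proof.
move=> x0; rewrite lt_def; apply/andP; split.
  apply: contra x0 => /eqP h; apply/eqP/colP => i; rewrite mxE; apply/eqP.
  move: h; rewrite /dot => /psumr_eq0P h.
  by rewrite -sqrf_eq0 expr2 h // => j _; rewrite -expr2 sqr_ge0.
by apply: sumr_ge0 => i _; rewrite -expr2 sqr_ge0.
Qed.

Lemma norm_le1_of_dot_eq1 (R : realType) (m : nat) (x : 'cV[R]_m) :
  dot x x = 1 -> `|x| <= 1.
Proof.
move=> x1; apply: norm_le_coord => // i.
rewrite -(@ler_pXn2r _ 2) ?nnegrE // expr1n real_normK ?num_real // -x1.
rewrite /dot (bigD1 i) //= -expr2 lerDl.
by apply: sumr_ge0 => j _; rewrite -expr2 sqr_ge0.
Qed.

Lemma is_derive_dot (R : realType) (m : nat) (g h : R -> 'cV[R]_m) (t : R)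
    (dg dh : 'cV[R]_m) :
  is_derive t 1 g dg -> is_derive t 1 h dh ->
  is_derive t (1 : R) (fun s => dot (g s) (h s)) (dot (g t) dh + dot (h t) dg).
Proof.
move=> /is_derive_coordP hg /is_derive_coordP hh.
have -> : (fun s => dot (g s) (h s)) = \sum_(i < m) (fun s => g s i 0 * h s i 0).
  by apply/funext => s; rewrite fct_sumE.
rewrite -big_split; apply: is_derive_sum => i.
have := hg i; have := hh i => h1 h2.
exact: (@is_deriveM _ _ (fun s => g s i 0) (fun s => h s i 0)).
Qed.

Lemma meval_homogeneous (R : realType) (m d : nat) (p : {mpoly R[m]}) (c : R)
    (v : 'I_m -> R) :
  p \is d.-homog -> p.@[fun i => c * v i] = c ^+ d * p.@[v].
Proof.
move=> /dhomogP hp; rewrite !mevalE mulr_sumr !big_seq.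
apply: eq_bigr => mon /hp; rewrite mulrCA => <-; congr (_ * _).
rewrite [X in c ^+ X]/= (mdegE mon) expr_sum -big_split.
by apply: eq_bigr => i _; rewrite exprMn.
Qed.

Lemma vf_evalZ (R : realType) (m d : nat) (chi : vfield R m) (c : R)
    (x : 'cV[R]_m) :
  vf_homogeneous d chi -> vf_eval chi (c *: x) = c ^+ d *: vf_eval chi x.
Proof.
move=> hd; apply/colP => i; rewrite !mxE -meval_homogeneous //.
by apply: meval_eq => j; rewrite mxE.
Qed.

(** The field [F] below is [chi] composed with the retraction, minus its
    component along [a]. Removing that component makes [a . F] vanish everywhere
    and so [a . g] constant; once [a . g = 0], the removed component no longer
    contributes to [g . F(g)], which vanishes because [chi] is homogeneous and
    tangent to spheres, so [g . g] is constant too. On the section [F] and [chi]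
    coincide. *)
Lemma complete_curve_in_hyperplane_section (R : realType) (m d : nat)
    (chi : vfield R m) (a x0 : 'cV[R]_m) :
  vf_homogeneous d chi ->
  (forall x, dot x (vf_eval chi x) = 0) ->
  (forall x, dot a x = 0 -> dot a (vf_eval chi x) = 0) ->
  dot a a = 1 -> hyperplane_section a x0 ->
  exists2 g : R -> 'cV[R]_m, g 0 = x0 &
    forall t : R, is_derive t 1 g (vf_eval chi (g t)) /\
      hyperplane_section a (g t).
Proof.
move=> hd tang inv a1 /hyperplane_sectionE[ax0 x01].
pose P x := vf_eval chi (ball_retraction x).
pose F x := P x - dot a (P x) *: a.
have blP i : bounded_lipschitz (fun x => P x i 0).
  rewrite /P; under eq_fun do rewrite mxE.
  by apply: bounded_lipschitz_meval => j; exact: bounded_lipschitz_ball_retraction.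
have [C FC FL] : exists2 C : R, (forall x, `|F x| <= C) &
    (forall x y, `|F x - F y| <= C * `|x - y|).
  apply: bounded_lipschitz_vector => i.
  have -> : (fun x => F x i 0) =
      (fun x => P x i 0 + dot a (P x) * - a i 0).
    by apply/funext => x; rewrite !mxE mulrN.
  apply: bounded_lipschitzD => //.
  apply: bounded_lipschitzM; last exact: bounded_lipschitz_cst.
  apply: bounded_lipschitz_sum => j.
  by apply: bounded_lipschitzM => //; exact: bounded_lipschitz_cst.
have [g g0 dg] := global_solution_of_bounded_lipschitz x0 FC FL.
have ag t : dot a (g t) = 0.
  rewrite -ax0 -g0; apply: (@is_derive_0_is_cst _ (fun s => dot a (g s))) => s.
  have -> : 0 = dot a (F (g s)) + dot (g s) 0.
    rewrite /F dotBr dotZr a1 mulr1 subrr add0r.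
    by rewrite -(scale0r a) dotZr mul0r.
  by apply: is_derive_dot (dg s); exact: is_derive_cst.
have gF t : dot (g t) (F (g t)) = 0.
  rewrite /F dotBr dotZr [dot _ a]dotC ag mulr0 subr0 /P.
  by rewrite (vf_evalZ _ _ hd) dotZr tang mulr0.
have gg t : dot (g t) (g t) = 1.
  rewrite -x01 -g0; apply: (@is_derive_0_is_cst _ (fun s => dot (g s) (g s))) => s.
  have -> : (0 : R) = dot (g s) (F (g s)) + dot (g s) (F (g s)).
    by rewrite gF addr0.
  exact: is_derive_dot (dg s) (dg s).
exists g => // t; split; last by apply/hyperplane_sectionE.
have := dg t; rewrite /F /P ball_retraction_id; last exact: norm_le1_of_dot_eq1.
by rewrite inv // scale0r subr0.
Qed.

(** * Tangency and homogeneity *)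

Lemma mderiv_var (R : realType) (m : nat) (i j : 'I_m) :
  ('X_j : {mpoly R[m]})^`M(i) = (i == j)%:R.
Proof.
rewrite mderivX mnm1E eq_sym; case: eqP => [->|_]; last by rewrite scale0r.
have -> : (U_(j) - U_(j) = 0 :> 'X_{1..m})%MM.
  by apply/mnmP => k; rewrite mnmBE mnm0E subnn.
by rewrite scale1r mpolyX0.
Qed.

Lemma vf_apply_linear_form (R : realType) (m : nat) (chi : vfield R m)
    (a : 'cV[R]_m) :
  vf_apply chi (linear_form a) = \sum_(i < m) a i 0 *: chi i.
Proof.
apply: eq_bigr => i _; rewrite /linear_form linear_sum (bigD1 i) //= big1 => [|j ji].
  by rewrite linearZ /= mderiv_var eqxx addr0 -scalerAr mulr1.
by rewrite linearZ /= mderiv_var eq_sym (negPf ji) scaler0.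
Qed.

Lemma vf_apply_sphere_poly (R : realType) (m : nat) (chi : vfield R m) :
  vf_apply chi (sphere_poly R m) = \sum_(i < m) chi i * ('X_i *+ 2).
Proof.
apply: eq_bigr => i _; congr (_ * _).
rewrite /sphere_poly linearB linear_sum /= (bigD1 i) //= big1 => [|j ji].
  rewrite -mpolyC1 mderivC subr0 addr0 expr2 mderivM mderiv_var eqxx.
  by rewrite mul1r mulr1 mulr2n.
by rewrite expr2 mderivM mderiv_var eq_sym (negPf ji) mul0r mulr0 addr0.
Qed.

Lemma vf_on_sphere_tangent (R : realType) (m : nat) (chi : vfield R m)
    (x : 'cV[R]_m) :
  vf_on_sphere chi -> dot x x = 1 -> dot x (vf_eval chi x) = 0.
Proof.
move=> [K]; rewrite /has_cofactor vf_apply_sphere_poly.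
move=> /(congr1 (meval (fun j => x j 0))); rewrite mevalM rmorph_sum /=.
rewrite /sphere_poly mevalB meval1 rmorph_sum /= => H x1.
have S1 : \sum_(i < m) ('X_i ^+ 2 : {mpoly R[m]}).@[fun j => x j 0] = 1.
  rewrite -x1; apply: eq_bigr => i _.
  by rewrite !expr2 mevalM mevalXU.
move: H; rewrite S1 subrr mulr0.
under eq_bigr do rewrite mevalM mevalMn mevalXU mulrnAr.
rewrite sumrMnl => /eqP; rewrite mulrn_eq0 /= => /eqP H.
by rewrite -[RHS]H; apply: eq_bigr => i _; rewrite mxE mulrC.
Qed.

(** Rescale a nonzero vector of the hyperplane to Euclidean length 1. With
    [a = 0] the hyperplane is the whole space. The degree is positive so that the value
    at 0 is also controlled. *)
Lemma homogeneous_eq0_on_hyperplane (R : realType) (m d : nat)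
    (q : 'cV[R]_m -> R) (a x : 'cV[R]_m) :
  (forall (c : R) y, q (c *: y) = c ^+ d.+1 * q y) ->
  (forall y, hyperplane_section a y -> q y = 0) ->
  dot a x = 0 -> q x = 0.
Proof.
move=> qZ q0 ax; have [->|x0] := eqVneq x 0.
  by have := qZ 0 0; rewrite scale0r expr0n mul0r.
have xx := dot_gt0 x0; pose r := Num.sqrt (dot x x).
have r0 : 0 < r by rewrite sqrtr_gt0.
have rr : r * r = dot x x by rewrite -expr2 sqr_sqrtr // ltW.
have -> : x = r *: (r^-1 *: x) by rewrite scalerA divff ?scale1r // gt_eqF.
rewrite qZ q0 ?mulr0 //; apply/hyperplane_sectionE; split.
  by rewrite dotZr ax mulr0.
rewrite dotZr dotZl -rr; field.
by rewrite gt_eqF.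
Qed.

(** * Quadratic forms vanishing on a hyperplane *)

Lemma dot_delta (R : realType) (m : nat) (i : 'I_m) (x : 'cV[R]_m) :
  dot (delta_mx i 0) x = x i 0.
Proof.
rewrite /dot (bigD1 i) //= big1 => [|j ji].
  by rewrite mxE !eqxx mul1r addr0.
by rewrite mxE (negPf ji) mul0r.
Qed.

Lemma dotE (R : realType) (m : nat) (x y : 'cV[R]_m) :
  dot x y = (x^T *m y) 0 0.
Proof. by rewrite mxE; apply: eq_bigr => i _; rewrite mxE. Qed.

Lemma dot_mulmxC (R : realType) (m : nat) (M : 'M[R]_m) (x y : 'cV[R]_m) :
  M^T = M -> dot x (M *m y) = dot y (M *m x).
Proof.
move=> sM; rewrite !dotE.
have -> : x^T *m (M *m y) = (y^T *m (M *m x))^T.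
  by rewrite !trmx_mul trmxK sM mulmxA.
by rewrite mxE.
Qed.

(** Let [p] be the orthogonal projection along [a]. By polarization the bilinear
    form of [M] vanishes on the image of [p], so [p M p = 0]; expanding
    [p = 1 - a a^T] leaves [M = a (M a)^T + (M a) a^T - s a a^T] with
    [s = a^T M a], and the last term is shared equally between the other two. *)
Lemma sym_mulmx_eq0_on_hyperplane (R : realType) (m : nat) (M : 'M[R]_m)
    (a : 'cV[R]_m) :
  M^T = M -> dot a a = 1 ->
  (forall x, dot a x = 0 -> dot x (M *m x) = 0) ->
  exists b : 'cV[R]_m, 2 *: M = a *m b^T + b *m a^T.
Proof.
move=> sM a1 M0; pose s := dot a (M *m a).
exists (2 *: (M *m a) - s *: a); apply/matrixP => i j.
pose p (k : 'I_m) : 'cV[R]_m := delta_mx k 0 - a k 0 *: a.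
have ap k : dot a (p k) = 0.
  by rewrite dotBr dotZr a1 mulr1 dotC dot_delta subrr.
have polar u v : dot a u = 0 -> dot a v = 0 -> dot u (M *m v) = 0.
  move=> au av; have := M0 (u + v); rewrite dotDr au av addr0 => /(_ erefl).
  by rewrite mulmxDr !dotDr !dotDl !M0 // (dot_mulmxC v u) //; lra.
have Mij := polar _ _ (ap i) (ap j).
have MjE : (M *m (delta_mx j 0 : 'cV[R]_m)) i 0 = M i j by rewrite -colE mxE.
move: Mij; rewrite /p mulmxBr -scalemxAr !dotBr !dotBl !dotZr !dotZl.
rewrite (dot_mulmxC a (delta_mx j 0)) // !dot_delta -/s MjE => H.
rewrite [LHS]mxE [RHS]mxE ![X in _ = X + _]mxE ![X in _ = _ + X]mxE !big_ord1.
rewrite !mxE in H *.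
lra.
Qed.

Lemma dot_mulmx_outer (R : realType) (m : nat) (a b x : 'cV[R]_m) :
  dot x (a *m b^T *m x) = dot a x * dot b x.
Proof.
rewrite -mulmxA; have -> : b^T *m x = (dot b x)%:M.
  by apply/matrixP => i j; rewrite !ord1 dotE [RHS]mxE.
by rewrite mul_mx_scalar dotZr mulrC dotC.
Qed.

Lemma quadratic_formE (R : realType) (m : nat) (M : 'M[R]_m) :
  quadratic_form M = \sum_(k < m) \sum_(j < m) M j k *: ('X_j * 'X_k).
Proof.
rewrite /quadratic_form mxE; apply: eq_bigr => k _.
rewrite !mxE mulr_suml; apply: eq_bigr => j _.
by rewrite !mxE -mulrA mulrCA mul_mpolyC.
Qed.

Lemma quadratic_form_sum (R : realType) (m : nat) (B : 'I_m -> 'M[R]_m)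
    (a : 'cV[R]_m) :
  \sum_(i < m) a i 0 *: quadratic_form (B i) =
  quadratic_form (\sum_(i < m) a i 0 *: B i).
Proof.
rewrite quadratic_formE; under eq_bigr do rewrite quadratic_formE scaler_sumr.
rewrite exchange_big; apply: eq_bigr => k _.
under eq_bigr do rewrite scaler_sumr.
rewrite exchange_big; apply: eq_bigr => j _.
rewrite summxE scaler_suml; apply: eq_bigr => i _.
by rewrite scalerA mxE.
Qed.

Lemma quadratic_form_outer (R : realType) (m : nat) (a b : 'cV[R]_m) :
  quadratic_form (a *m b^T) = linear_form b * linear_form a.
Proof.
rewrite quadratic_formE /linear_form mulr_suml; apply: eq_bigr => k _.
rewrite mulr_sumr; apply: eq_bigr => j _.
rewrite mxE big_ord1 mxE -scalerAl -scalerAr scalerA mulrC.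
by rewrite ['X_j * _]mulrC.
Qed.

Lemma meval_quadratic_form (R : realType) (m : nat) (M : 'M[R]_m)
    (x : 'cV[R]_m) :
  (quadratic_form M).@[fun j => x j 0] = dot x (M *m x).
Proof.
rewrite quadratic_formE rmorph_sum /=.
under eq_bigr do rewrite rmorph_sum /=.
rewrite exchange_big; apply: eq_bigr => j _ /=.
rewrite mxE mulr_sumr; apply: eq_bigr => k _.
by rewrite mevalZ mevalM !mevalXU mulrCA.
Qed.

Lemma dot_vf_eval_quadratic (R : realType) (m : nat) (chi : vfield R m)
    (B : 'I_m -> 'M[R]_m) (a x : 'cV[R]_m) :
  (forall i, chi i = quadratic_form (B i)) ->
  dot a (vf_eval chi x) = dot x ((\sum_(i < m) a i 0 *: B i) *m x).
Proof.
move=> hB; rewrite -meval_quadratic_form -quadratic_form_sum rmorph_sum /=.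
by apply: eq_bigr => i _; rewrite mevalZ mxE hB.
Qed.

(** * Invariance of great spheres *)

(** The domain [I] of a trajectory is open and [a . g] vanishes on it, so the
    derivative of [a . g] at a time when the trajectory is at [x] is 0; it is
    also [a . chi(x)]. *)
Lemma invariant_section_orthogonal (R : realType) (m : nat) (chi : vfield R m)
    (a x : 'cV[R]_m) :
  invariant_set chi (hyperplane_section a) -> hyperplane_section a x ->
  dot a (vf_eval chi x) = 0.
Proof.
move=> [F [Ftraj SF]] Sx.
have [T FT Tx] : (\bigcup_(T in F) T) x by rewrite -SF.
have [I [g [[[_ oI _ dg] _] TE]]] := Ftraj _ FT.
have [t It gt] : (g @` I) x by rewrite -TE.
have ag s : I s -> dot a (g s) = 0.
  move=> Is; have /hyperplane_sectionE[] // : hyperplane_section a (g s).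
  by rewrite SF; exists T => //; rewrite TE; exists s.
have D1 : is_derive t (1 : R) (fun s => dot a (g s))
    (dot a (vf_eval chi (g t)) + dot (g t) 0).
  by apply: is_derive_dot (dg _ It); exact: is_derive_cst.
have D2 : is_derive t (1 : R) (fun s => dot a (g s)) 0.
  apply: (@near_eq_is_derive _ _ _ (cst 0)).
  by apply: filterS (open_nbhs_nbhs (conj oI It)) => s Is; rewrite /= ag.
have := @derive_val _ _ _ _ _ _ _ D1; rewrite (@derive_val _ _ _ _ _ _ _ D2) gt.
by rewrite -(scale0r a) dotZr mul0r addr0.
Qed.

(** An integral curve defined on the whole line cannot be extended, so its image
    is a trajectory. *)
Lemma invariant_great_sphere_of_complete_curves (R : realType) (m : nat)
    (chi : vfield R m) (a : 'cV[R]_m) :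
  dot a a = 1 ->
  (forall x, hyperplane_section a x -> exists2 g : R -> 'cV[R]_m, g 0 = x &
     forall t : R, is_derive t 1 g (vf_eval chi (g t)) /\
       hyperplane_section a (g t)) ->
  invariant_great_sphere chi (hyperplane_section a).
Proof.
move=> a1 H; split.
  by exists a; split=> //; rewrite -a1; apply: eq_bigr => i _; rewrite expr2.
exists [set T | trajectory chi T /\ T `<=` hyperplane_section a].
split=> [T []//|]; apply/seteqP; split=> [x Sx|x [T [_ TS] Tx]]; last exact: TS.
have [g g0 dg] := H _ Sx.
exists (g @` setT); last by exists 0.
split=> [|_ [t _ <-]]; last by have [] := dg t.
exists setT, g; split=> //; split.
  split; [by exists 0|exact: openT|by []|].
  by move=> t _; have [] := dg t.
by move=> J h _ sJ _; apply/seteqP; split.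
Qed.

Unset Implicit Arguments.

Theorem theorem1p7 (R : realType) (n : nat) (hn : (2 <= n)%N)
    (chi : vfield R n.+1) (B : 'I_n.+1 -> 'M[R]_n.+1)
    (hhom : vf_homogeneous 2 chi)
    (hsphere : vf_on_sphere chi)
    (hsym : forall i, (B i)^T = B i)
    (hB : forall i, chi i = quadratic_form (B i))
    (a : 'cV[R]_n.+1) (ha : \sum_(i < n.+1) a i 0 ^+ 2 = 1) :
  (invariant_great_sphere chi (hyperplane_section a) <->
   exists b : 'cV[R]_n.+1,
     2 *: (\sum_(i < n.+1) a i 0 *: B i) = a *m b^T + b *m a^T) /\
  (forall lam : 'I_n.+1 -> R,
     (forall i, eigenvector (column_matrix B i) (lam i) a) ->
     invariant_great_sphere chi (hyperplane_section a) /\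
     has_cofactor chi (linear_form a) (\sum_(i < n.+1) lam i *: 'X_i)).
Proof.
set Q := \sum_(i < n.+1) a i 0 *: B i.
have a1 : dot a a = 1 by rewrite -ha; apply: eq_bigr => i _; rewrite expr2.
have sQ : Q^T = Q.
  by rewrite linear_sum; apply: eq_bigr => i _; rewrite linearZ /= hsym.
have dotQ x : dot a (vf_eval chi x) = dot x (Q *m x).
  exact: dot_vf_eval_quadratic.
(* Tangency holds off the sphere too: [x . chi(x)] is homogeneous of degree 3. *)
have tang x : dot x (vf_eval chi x) = 0.
  apply: (@homogeneous_eq0_on_hyperplane _ _ 2
    (fun y => dot y (vf_eval chi y)) 0) => [c y|y /hyperplane_sectionE[_ y1]|].
  - by rewrite (vf_evalZ _ _ hhom) dotZl dotZr mulrA -exprS.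
  - exact: vf_on_sphere_tangent.
  - by rewrite -(scale0r x) dotZl mul0r.
have suff_mx (b : 'cV[R]_n.+1) : 2 *: Q = a *m b^T + b *m a^T ->
    invariant_great_sphere chi (hyperplane_section a).
  move=> Qb; apply: invariant_great_sphere_of_complete_curves => // x Sx.
  apply: complete_curve_in_hyperplane_section => // y ay; rewrite dotQ.
  have : 2 * dot y (Q *m y) = 0.
    rewrite -dotZr scalemxAl Qb mulmxDl dotDr !dot_mulmx_outer ay.
    by rewrite mulr0 mul0r addr0.
  lra.
split.
  split=> [[_ inv]|[b]]; last exact: suff_mx.
  apply: sym_mulmx_eq0_on_hyperplane => // x ax; rewrite -dotQ.
  apply: (@homogeneous_eq0_on_hyperplane _ _ 1
    (fun y => dot a (vf_eval chi y)) a) => // [c y|y].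
    by rewrite (vf_evalZ _ _ hhom) dotZr.
  exact: invariant_section_orthogonal.
move=> lam hlam; pose l : 'cV[R]_n.+1 := \col_i lam i.
have Ql : Q = a *m l^T.
  apply/matrixP => k i; have [_ /matrixP/(_ k 0)] := hlam i.
  rewrite [RHS]mxE => hk; rewrite [RHS]mxE big_ord1 !mxE mulrC -hk.
  rewrite summxE [RHS]mxE; apply: eq_bigr => j _.
  by rewrite [X in _ = X * _]mxE -colE !mxE mulrC.
split.
  have Ql' : Q = l *m a^T by rewrite -sQ Ql trmx_mul trmxK.
  by apply: (suff_mx l); rewrite -Ql -Ql' scaler_nat mulr2n.
rewrite /has_cofactor vf_apply_linear_form.
under eq_bigr do rewrite hB.
rewrite quadratic_form_sum -/Q Ql quadratic_form_outer; congr (_ * _).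
by apply: eq_bigr => i _; rewrite mxE.
Qed.
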